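(* Let $\tau>0$ be a given user-defined eigenvalue threshold. Let $V_0 = V_G + V_{\mathrm{GenEO}}^{\tau}$ be the coarse space built from the split near-kernel space and the GenEO eigenvectors with threshold $\tau$, let $Z$ be a matrix whose columns form a basis of $V_0$, let $P_0 = Z(Z^TAZ)^{-1}Z^TA$, and let $$M^{-1}_{\mathrm{AS},2} = Z(Z^TAZ)^{-1}Z^T + (I-P_0)\sum_{i=1}^N R_i^T (R_iAR_i^T)^{-1}R_i\,(I-P_0^T)$$ be the associated two-level additive Schwarz preconditioner. Then the spectral condition number satisfies $$\kappa(M^{-1}_{\mathrm{AS},2}A) \le (1+k_1\tau)\,k_0 .$$
   Context: Problem. $\Omega\subset\mathbb{R}^3$ is a bounded domain, $\gamma>0$, and $\mu,\varepsilon$ are (possibly heterogeneous) coefficients on $\Omega$, uniformly bounded and strictly positive (bounded above and below by positive constants). The bilinear form is $a(\mathbf{u},\mathbf{v})=\int_\Omega \mu^{-1}(\nabla\times\mathbf{u})\cdot(\nabla\times\mathbf{v})+\gamma\varepsilon\,\mathbf{u}\cdot\mathbf{v}\,\mathrm{d}\mathbf{x}$ on $\mathbf{H}_0(\mathbf{curl},\Omega)$ (boundary condition $\mathbf{u}\times\mathbf{n}=0$ on $\partial\Omega$). It is discretised on a mesh $\mathcal{T}_h$ of $\Omega$ by a conforming finite element space (e.g. Nédélec elements) with basis $(\phi_k)_{k\in\mathcal{N}}$, $\#\mathcal{N}=n$, giving the symmetric positive definite matrix $A\in\mathbb{R}^{n\times n}$, $A_{kl}=a(\phi_l,\phi_k)$;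 for coefficient vectors write also $a(\mathbf{U},\mathbf{V})=(A\mathbf{U},\mathbf{V})$, with $(\cdot,\cdot)$ the Euclidean inner product. Domain decomposition. $\Omega=\bigcup_{i=1}^N\Omega_i$ is an overlapping decomposition into subdomains that are unions of mesh elements. $\mathcal{N}_i\subset\mathcal{N}$, of size $n_i$, is the set of degrees of freedom contained in $\Omega_i$ (those $k$ for which $\phi_k$ does not vanish identically on $\Omega_i$), and $R_i:\mathbb{R}^n\to\mathbb{R}^{n_i}$ is the restriction to $\mathcal{N}_i$. The local Neumann matrix $A_i^{\mathrm{Neu}}\in\mathbb{R}^{n_i\times n_i}$ has entries $a_{\Omega_i}(\phi_l,\phi_k)$, $k,l\in\mathcal{N}_i$, where $a_{\Omega_i}$ is the form $a$ with the integral taken over $\Omega_i$ only; it is symmetric positive definite. The matrices $D_i\in\mathbb{R}^{n_i\times n_i}$ are diagonal with non-negative entries and satisfy the partition of unity $\sum_{i=1}^N R_i^TD_iR_i=I$. Constants. $k_0:=\max_{1\le i\le N}\#\{j \mid R_jAR_i^T\ne0\}$. $k_1$ is the largest number of subdomains whose intersection has non-zero measure. Split near-kernel space. $G\subset\mathbb{R}^n$ is a given linear subspace, the easily computable part of the near-kernel of $A$ (in the application, the vectors stemming from gradients of $H^1$ functions). $G_i:=R_iG\subset\mathbb{R}^{n_i}$, and $V_G\subset\mathbb{R}^n$ is the span of the subspaces $R_i^TD_iG_i$, $1\le i\le N$. Projections. $b_i(\mathbf{U}_i,\mathbf{V}_i):=(R_iAR_i^T\mathbf{U}_i,\mathbf{V}_i)$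 on $\mathbb{R}^{n_i}$, and $\xi_{0i}$ is the $b_i$-orthogonal projection of $\mathbb{R}^{n_i}$ onto $G_i$. GenEO space. For each $1\le j\le N$ consider the generalised eigenvalue problem: find $(\mathbf{V}_{jk},\lambda_{jk})\in(\mathbb{R}^{n_j}\setminus\{0\})\times\mathbb{R}$ such that $$(I-\xi_{0j}^T)D_jR_jAR_j^TD_j(I-\xi_{0j})\mathbf{V}_{jk}=\lambda_{jk}A_j^{\mathrm{Neu}}\mathbf{V}_{jk}.$$ $V_{j,\mathrm{GenEO}}^\tau\subset\mathbb{R}^n$ is the span of the vectors $R_j^TD_j(I-\xi_{0j})\mathbf{V}_{jk}$ with $\lambda_{jk}>\tau$, and $V_{\mathrm{GenEO}}^\tau$ is the span of all $V_{j,\mathrm{GenEO}}^\tau$, $1\le j\le N$. For a matrix $M^{-1}A$ with $M^{-1}$ and $A$ symmetric positive definite, $\kappa(M^{-1}A)$ denotes the ratio of its largest to its smallest eigenvalue. *)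

(* Defs.v *)
From HB Require Import structures.
From mathcomp Require Import all_boot all_order all_algebra.
From mathcomp Require Import all_classical all_reals all_analysis.

Set Implicit Arguments.
Unset Strict Implicit.
Unset Printing Implicit Defensive.

Import Order.TTheory GRing.Theory Num.Theory.
Import numFieldNormedType.Exports.

Local Open Scope classical_set_scope.
Local Open Scope ring_scope.

(* Points are triples, so that the product Lebesgue measure and the product
   topology both apply; the values of vector fields are row vectors. *)
Notation R3 R := (R * R * R)%type.

(* The same triples, with the measurable structure that carries
   lebesgue_measure (the Borel sigma-algebra in both cases). *)
Notation mR3 R := (measurableTypeR R * measurableTypeR R * measurableTypeR R)%type.

Definition leb3 (R : realType) : {measure set (mR3 R) -> \bar R} :=
  ((@lebesgue_measure R \x @lebesgue_measure R) \x @lebesgue_measure R)%E.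

Definition axis (R : realType) (j : 'I_3) : R3 R :=
  ((j == 0)%:R, (j == 1)%:R, (j == 2%:R)%:R).

(* The indices j + 1 and j + 2 are computed in Z/3Z:
   (curl u)_j = d_{j+1} u_{j+2} - d_{j+2} u_{j+1}. *)
Definition curl (R : realType) (u : R3 R -> 'rV[R]_3) (x : R3 R) : 'rV[R]_3 :=
  \row_(j < 3) ('D_(axis R (j + 1)) (fun y => u y 0 (j + 2%:R)) x
              - 'D_(axis R (j + 2%:R)) (fun y => u y 0 (j + 1)) x).

Definition dotr (R : realType) (u v : 'rV[R]_3) : R :=
  \sum_(j < 3) u 0 j * v 0 j.

(* C^oo: all iterated directional derivatives are differentiable everywhere *)
Definition smooth (R : realType) (f : R3 R -> R) : Prop :=
  forall (s : seq (R3 R)) (x : R3 R),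
    differentiable (foldr (fun v g => 'D_v g) f s) x.

Definition test_field (R : realType) (Om : set (R3 R))
    (v : R3 R -> 'rV[R]_3) : Prop :=
  (forall j, smooth (fun x => v x 0 j)) /\
  (exists C : set (R3 R),
    [/\ compact C, C `<=` Om & forall x, ~ C x -> v x = 0]).

Definition L2_field (R : realType) (Om : set (R3 R))
    (u : R3 R -> 'rV[R]_3) : Prop :=
  forall j, measurable_fun (Om : set (mR3 R)) (fun x => u x 0 j) /\
            (leb3 R).-integrable Om (fun x => (u x 0 j ^+ 2)%:E).

(* u belongs to H_0(curl, Om), the closure of the smooth compactly supported
   fields in the graph norm of the curl, and w is (a representative of) its
   weak curl; being in the closure encodes the condition u x n = 0. *)
Definition H0curl (R : realType) (Om : set (R3 R))
    (u w : R3 R -> 'rV[R]_3) : Prop :=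
  [/\ L2_field Om u, L2_field Om w &
    exists v : nat -> R3 R -> 'rV[R]_3,
      (forall m, test_field Om (v m)) /\
      (fun m => \int[leb3 R]_(x in Om)
          (dotr (v m x - u x) (v m x - u x)
           + dotr (curl (v m) x - w x) (curl (v m) x - w x))%:E)%E
        @ \oo --> 0%E].

Definition bounded_domain (R : realType) (Om : set (R3 R)) : Prop :=
  [/\ open Om, connected Om, Om !=set0 & bounded_set Om].

Definition coefficient (R : realType) (Om : set (R3 R)) (f : R3 R -> R) : Prop :=
  measurable_fun (Om : set (mR3 R)) f /\
  (exists c C : R, 0 < c /\ forall x, Om x -> c <= f x <= C).

(* The elements are the closed cells (tetrahedra, possibly curved or
   hexahedral) of the mesh. *)
Record is_mesh (R : realType) (M : nat) (Om : set (R3 R))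
    (K : 'I_M -> set (R3 R)) : Prop := IsMesh {
  mesh_compact : forall t, compact (K t);
  mesh_nonempty : forall t, interior (K t) !=set0;
  mesh_regular : forall t, closure (interior (K t)) = K t;
  mesh_boundary : forall t, leb3 R (K t `\` interior (K t)) = 0%E;
  mesh_inside : forall t, interior (K t) `<=` Om;
  mesh_disjoint : trivIset setT (fun t => interior (K t));
  mesh_cover : \bigcup_t K t = closure Om }.

(* Finite element fields are differentiable inside every element and their
   curl is computed elementwise; conformity in H_0(curl) says that this
   elementwise curl is their weak curl.  Values on element faces are
   irrelevant, hence linear independence is that of classes modulo a.e.
   equality. *)
Record fe_basis (R : realType) (M n : nat) (Om : set (R3 R))
    (K : 'I_M -> set (R3 R)) (phi : 'I_n -> R3 R -> 'rV[R]_3) : Prop := FeBasis {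
  fe_piecewise : forall k t x, interior (K t) x -> differentiable (phi k) x;
  fe_conforming : forall k, H0curl Om (phi k) (curl (phi k));
  fe_free : forall c : 'I_n -> R,
    {ae leb3 R, forall x, Om x -> \sum_k c k *: phi k x = 0} ->
    forall k, c k = 0 }.

(* The form a_S, the integral being taken over S. *)
Definition form (R : realType) (mu eps : R3 R -> R) (gamma : R)
    (S : set (R3 R)) (u v : R3 R -> 'rV[R]_3) : R :=
  Rintegral (leb3 R) S (fun x =>
    (mu x)^-1 * dotr (curl u x) (curl v x) + gamma * eps x * dotr (u x) (v x)).

Definition stiffness (R : realType) (n : nat) (mu eps : R3 R -> R) (gamma : R)
    (Om : set (R3 R)) (phi : 'I_n -> R3 R -> 'rV[R]_3) : 'M[R]_n :=
  \matrix_(k, l) form mu eps gamma Om (phi l) (phi k).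

(* The part in Om of the union of the closed elements indexed by T. *)
Definition subdomain (R : realType) (M : nat) (Om : set (R3 R))
    (K : 'I_M -> set (R3 R)) (T : {set 'I_M}) : set (R3 R) :=
  Om `&` \bigcup_(t in [set` T]) K t.

Definition dofs (R : realType) (n : nat) (phi : 'I_n -> R3 R -> 'rV[R]_3)
    (S : set (R3 R)) : {set 'I_n} :=
  [set k | `[< ~ {ae leb3 R, forall x, S x -> phi k x = 0} >]]%SET.

Definition restr (R : realType) (n : nat) (I : {set 'I_n}) : 'M[R]_(#|I|, n) :=
  rowsub (fun a : 'I_#|I| => enum_val a) 1%:M.

Definition neumann (R : realType) (n : nat) (mu eps : R3 R -> R) (gamma : R)
    (phi : 'I_n -> R3 R -> 'rV[R]_3) (S : set (R3 R)) (I : {set 'I_n}) :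
    'M[R]_#|I| :=
  \matrix_(a, b) form mu eps gamma S (phi (enum_val b)) (phi (enum_val a)).

Definition k0 (R : realType) (n N : nat) (A : 'M[R]_n)
    (I : 'I_N -> {set 'I_n}) : nat :=
  \max_(i < N)
    #|[set j : 'I_N | (restr R (I j) *m A *m (restr R (I i))^T != 0)%R]%SET|.

Definition k1 (R : realType) (N : nat) (Omi : 'I_N -> set (R3 R)) : nat :=
  \max_(J : {set 'I_N} | leb3 R (\bigcap_(i in [set` J]) Omi i) != 0%E) #|J|.

Definition dotc (R : realType) (m : nat) (u v : 'cV[R]_m) : R := (u^T *m v) 0 0.

Definition spd (R : realType) (m : nat) (A : 'M[R]_m) : Prop :=
  A^T = A /\ forall u : 'cV[R]_m, u != 0 -> 0 < dotc (A *m u) u.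

Definition orth_proj (R : realType) (m : nat) (B : 'M[R]_m)
    (W : {vspace 'cV[R]_m}) (P : 'M[R]_m) : Prop :=
  forall u : 'cV[R]_m, P *m u \in W /\
    (forall w, w \in W -> dotc (B *m (u - P *m u)) w = 0).

Definition mximage (R : realType) (m p : nat) (B : 'M[R]_(p, m))
    (W : {vspace 'cV[R]_m}) : {vspace 'cV[R]_p} :=
  (linfun (mulmx B : 'cV[R]_m -> 'cV[R]_p) @: W)%VS.

Definition lin_span (R : realType) (V : vectType R) (S : set V) : set V :=
  [set v | exists2 s : seq V, (forall w, w \in s -> S w) & v \in span s].

Definition gen_eigen (R : realType) (m : nat) (B C : 'M[R]_m)
    (v : 'cV[R]_m) (lam : R) : Prop :=
  v != 0 /\ B *m v = lam *: (C *m v).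

Definition basis_mx (R : realType) (n m : nat) (Z : 'M[R]_(n, m))
    (W : set 'cV[R]_n) : Prop :=
  row_free Z^T /\ W = [set Z *m c | c in [set: 'cV[R]_m]].

(* Largest over smallest eigenvalue: the set of eigenvalues is finite. *)
Definition cond (R : realType) (n : nat) (B : 'M[R]_n) : R :=
  sup [set x | eigenvalue B x] / inf [set x | eigenvalue B x].

Definition local_mx (R : realType) (n : nat) (A : 'M[R]_n) (I : {set 'I_n}) :
    'M[R]_#|I| :=
  restr R I *m A *m (restr R I)^T.

Definition V_G (R : realType) (n N : nat) (I : 'I_N -> {set 'I_n})
    (D : forall i, 'M[R]_#|I i|) (G : {vspace 'cV[R]_n}) : {vspace 'cV[R]_n} :=
  (\sum_(i < N)
     mximage ((restr R (I i))^T *m D i) (mximage (restr R (I i)) G))%VS.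

Definition V_GenEO_loc (R : realType) (n : nat) (A : 'M[R]_n) (I : {set 'I_n})
    (ANeu D xi : 'M[R]_#|I|) (tau : R) : set 'cV[R]_n :=
  lin_span [set u | exists v lam,
    [/\ gen_eigen
          ((1%:M - xi^T) *m D *m local_mx A I *m D *m (1%:M - xi)) ANeu v lam,
        tau < lam &
        u = (restr R I)^T *m D *m (1%:M - xi) *m v]].

Definition V_GenEO (R : realType) (n N : nat) (A : 'M[R]_n)
    (I : 'I_N -> {set 'I_n}) (ANeu D xi : forall i, 'M[R]_#|I i|) (tau : R) :
    set 'cV[R]_n :=
  lin_span (\bigcup_j V_GenEO_loc A (ANeu j) (D j) (xi j) tau).

Definition V_0 (R : realType) (n N : nat) (A : 'M[R]_n)
    (I : 'I_N -> {set 'I_n}) (ANeu D xi : forall i, 'M[R]_#|I i|)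
    (G : {vspace 'cV[R]_n}) (tau : R) : set 'cV[R]_n :=
  [set u + w | u in [set` V_G D G] & w in V_GenEO A ANeu D xi tau].

Definition P_0 (R : realType) (n m : nat) (A : 'M[R]_n) (Z : 'M[R]_(n, m)) :
    'M[R]_n :=
  Z *m invmx (Z^T *m A *m Z) *m Z^T *m A.

Definition M_AS2_inv (R : realType) (n N m : nat) (A : 'M[R]_n)
    (I : 'I_N -> {set 'I_n}) (Z : 'M[R]_(n, m)) : 'M[R]_n :=
  Z *m invmx (Z^T *m A *m Z) *m Z^T
  + (1%:M - P_0 A Z)
    *m (\sum_(i < N)
          (restr R (I i))^T *m invmx (local_mx A (I i)) *m restr R (I i))
    *m (1%:M - (P_0 A Z)^T).

(* Main.v *)
(* Let u' = (I - P_0) u be the part of u that is A-orthogonal to V_0, and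
   s = sum_i (B_i^-1 R_i A u', R_i A u') with B_i = R_i A R_i^T.  If u is an
   eigenvector of M^-1 A for lam, then
     lam a(u, u) = a(P_0 u, P_0 u) + s   and
     a(u, u) = a(P_0 u, P_0 u) + a(u', u'),
   so it suffices to compare s with a(u', u').
   - s <= k_0 a(u', u'): one has s = a(u', sum_i w_i) where
     w_i = R_i^T B_i^-1 R_i A u', and for every i at most k_0 of the products
     a(w_i, w_j) are nonzero.
   - a(u', u') <= k_1 tau s: every u is, modulo V_0, a sum of R_i^T w_i with
     sum_i (B_i w_i, w_i) <= tau sum_i a_{Om_i}(u, u) <= k_1 tau a(u, u); the
     w_i are obtained from D_i (I - xi_i) R_i u by discarding the components
     on the eigenvectors above tau.
   The inequality sum_i a_{Om_i} <= k_1 a, which also makes A positive definite,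
   holds because almost every point lies in at most k_1 subdomains. *)

Require Import Defs.
From mathcomp Require Import all_boot all_order all_algebra.
From mathcomp Require Import all_classical all_reals all_analysis.
From mathcomp Require Import measurable_realfun ring lra.

Set Implicit Arguments.
Unset Strict Implicit.
Unset Printing Implicit Defensive.

Import Order.TTheory GRing.Theory Num.Theory.
Import numFieldNormedType.Exports.

Local Open Scope classical_set_scope.
Local Open Scope ring_scope.

(** * Quadratic forms *)

Section dotc_theory.
Context {R : realType}.

Lemma dotcC m (u v : 'cV[R]_m) : dotc u v = dotc v u.
Proof. by rewrite /dotc -[in LHS](trmxK (_ *m _)) trmx_mul trmxK mxE. Qed.

Lemma dotcDl m (u v w : 'cV[R]_m) : dotc (u + v) w = dotc u w + dotc v w.
Proof. by rewrite /dotc linearD mulmxDl mxE. Qed.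

Lemma dotcDr m (u v w : 'cV[R]_m) : dotc w (u + v) = dotc w u + dotc w v.
Proof. by rewrite /dotc mulmxDr mxE. Qed.

Lemma dotcNl m (u v : 'cV[R]_m) : dotc (- u) v = - dotc u v.
Proof. by rewrite /dotc linearN mulNmx mxE. Qed.

Lemma dotcNr m (u v : 'cV[R]_m) : dotc u (- v) = - dotc u v.
Proof. by rewrite /dotc mulmxN mxE. Qed.

Lemma dotcZl m a (u v : 'cV[R]_m) : dotc (a *: u) v = a * dotc u v.
Proof. by rewrite /dotc linearZ -scalemxAl mxE. Qed.

Lemma dotcZr m a (u v : 'cV[R]_m) : dotc u (a *: v) = a * dotc u v.
Proof. by rewrite /dotc -scalemxAr mxE. Qed.

Lemma dotc0l m (u : 'cV[R]_m) : dotc 0 u = 0.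
Proof. by rewrite /dotc trmx0 mul0mx mxE. Qed.

Lemma dotc0r m (u : 'cV[R]_m) : dotc u 0 = 0.
Proof. by rewrite /dotc mulmx0 mxE. Qed.

Lemma dotc_suml m (J : Type) (r : seq J) P (F : J -> 'cV[R]_m) u :
  dotc (\sum_(j <- r | P j) F j) u = \sum_(j <- r | P j) dotc (F j) u.
Proof.
by rewrite (big_morph (fun v => dotc v u) (fun v w => dotcDl v w u) (dotc0l u)).
Qed.

Lemma dotc_sumr m (J : Type) (r : seq J) P (F : J -> 'cV[R]_m) u :
  dotc u (\sum_(j <- r | P j) F j) = \sum_(j <- r | P j) dotc u (F j).
Proof. by rewrite dotcC dotc_suml; apply: eq_bigr => j _; rewrite dotcC. Qed.

Lemma dotc_mull m p (B : 'M[R]_(m, p)) u v :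
  dotc (B *m u) v = dotc u (B^T *m v).
Proof. by rewrite /dotc trmx_mul mulmxA. Qed.

Lemma dotcE m (u v : 'cV[R]_m) : dotc u v = \sum_i u i 0 * v i 0.
Proof. by rewrite /dotc mxE; apply: eq_bigr => i _; rewrite mxE. Qed.

Lemma dotc_ge0 m (u : 'cV[R]_m) : 0 <= dotc u u.
Proof. by rewrite dotcE; apply: sumr_ge0 => i _; rewrite -expr2 sqr_ge0. Qed.

Lemma dotc_eq0 m (u : 'cV[R]_m) : (dotc u u == 0) = (u == 0).
Proof.
apply/idP/eqP => [|->]; last by rewrite dotc0l.
rewrite dotcE psumr_eq0 => [/allP h|i _]; last by rewrite -expr2 sqr_ge0.
apply/colP => i; rewrite mxE; apply/eqP.
by have := h i (mem_index_enum i); rewrite /= -expr2 sqrf_eq0.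
Qed.

Lemma dotc_gt0 m (u : 'cV[R]_m) : u != 0 -> 0 < dotc u u.
Proof. by move=> u0; rewrite lt_neqAle eq_sym dotc_eq0 u0 dotc_ge0. Qed.

Definition psd m (B : 'M[R]_m) :=
  B^T = B /\ forall u : 'cV[R]_m, 0 <= dotc (B *m u) u.

Lemma spd_psd m (B : 'M[R]_m) : spd B -> psd B.
Proof.
move=> [sB pB]; split=> // u; have [->|/pB/ltW//] := eqVneq u 0.
by rewrite dotc0r.
Qed.

Lemma dotc_sym m (B : 'M[R]_m) u v :
  B^T = B -> dotc (B *m u) v = dotc (B *m v) u.
Proof. by move=> sB; rewrite dotc_mull sB dotcC. Qed.

Lemma congruence_sym m p (B : 'M[R]_m) (M : 'M[R]_(m, p)) :
  B^T = B -> (M^T *m B *m M)^T = M^T *m B *m M.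
Proof. by move=> sB; rewrite !trmx_mul trmxK sB mulmxA. Qed.

Lemma quad_congruence m p (B : 'M[R]_m) (M : 'M[R]_(m, p)) v :
  dotc (M^T *m B *m M *m v) v = dotc (B *m (M *m v)) (M *m v).
Proof. by rewrite -!mulmxA dotc_mull trmxK. Qed.

Lemma quadZ m (B : 'M[R]_m) a u :
  dotc (B *m (a *: u)) (a *: u) = a ^+ 2 * dotc (B *m u) u.
Proof. by rewrite -scalemxAr dotcZl dotcZr expr2 mulrA. Qed.

Lemma quadD m (B : 'M[R]_m) u v : B^T = B ->
  dotc (B *m (u + v)) (u + v) =
  dotc (B *m u) u + 2 * dotc (B *m u) v + dotc (B *m v) v.
Proof.
move=> sB; rewrite mulmxDr !dotcDl !dotcDr (dotc_sym v u sB); ring.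
Qed.

(** Nonnegativity of the form at [t *: u - v], expanded. *)
Lemma psd_young m (B : 'M[R]_m) t u v : psd B ->
  2 * t * dotc (B *m u) v <= t ^+ 2 * dotc (B *m u) u + dotc (B *m v) v.
Proof.
move=> [sB pB]; have := pB (t *: u - v).
rewrite quadD// quadZ !(mulmxN, dotcNl, dotcNr) opprK -scalemxAr dotcZl.
by move=> h; lra.
Qed.

Lemma psd_cauchy m (B : 'M[R]_m) u v : psd B ->
  dotc (B *m u) v ^+ 2 <= dotc (B *m u) u * dotc (B *m v) v.
Proof.
move=> pB; have [h|h] := ltP 0 (dotc (B *m u) u).
  have := @psd_young m B (dotc (B *m u) v / dotc (B *m u) u) u v pB.
  set a := dotc _ u; set b := dotc _ v; set c := dotc _ v.
  rewrite -/a in h.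
  have -> : 2 * (b / a) * b = 2 * (b ^+ 2 / a) by field; lra.
  have -> : (b / a) ^+ 2 * a = b ^+ 2 / a by field; lra.
  move=> h'; have : b ^+ 2 / a <= c by lra.
  by rewrite ler_pdivrMr// mulrC.
have {h} h : dotc (B *m u) u = 0 by apply/eqP; rewrite eq_le h pB.2.
rewrite h mul0r; set b := dotc _ v; set c := dotc (B *m v) v.
have [->|b0] := eqVneq b 0; first by rewrite expr0n.
(* When the form vanishes at [u], the left side of Young's inequality is unbounded in [t]; this [t]
   makes it [c + 1], which exceeds the right side [c]. *)
have := @psd_young m B ((c + 1) / (2 * b)) u v pB.
rewrite h -/b -/c.
have -> : 2 * ((c + 1) / (2 * b)) * b = c + 1 by field.
by move=> ?; lra.
Qed.

Lemma spd_unit m (B : 'M[R]_m) : spd B -> B \in unitmx.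
Proof.
move=> [sB pB]; rewrite -row_free_unit -kermx_eq0; apply/eqP/row_matrixP => i.
set w := row _ _; rewrite row0.
have wB : w *m B = 0 by apply/sub_kermxP/row_sub.
apply: trmx_inj; rewrite trmx0; apply/eqP; apply: contraT => /pB.
by rewrite -[X in dotc (X *m _)]sB -trmx_mul wB trmx0 dotc0l ltxx.
Qed.

Lemma dotc_bounded m (B : 'M[R]_m) :
  exists2 K : R, 0 < K & forall u, dotc (B *m u) u <= K * dotc u u.
Proof.
exists (1 + \sum_i \sum_j `|B i j|).
  by rewrite ltr_pwDl ?ltr01//; do 2 apply: sumr_ge0 => ? _.
move=> u.
have -> : dotc (B *m u) u = \sum_i \sum_j B i j * (u j 0 * u i 0).
  rewrite dotcE; apply: eq_bigr => i _; rewrite mxE mulr_suml.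
  by apply: eq_bigr => j _; rewrite mulrA.
rewrite mulrDl mul1r ler_wpDl ?dotc_ge0// mulr_suml ler_sum// => i _.
rewrite mulr_suml ler_sum// => j _.
apply: (le_trans (ler_norm _)); rewrite normrM ler_wpM2l//.
have le_sq k : u k 0 ^+ 2 <= dotc u u.
  rewrite dotcE (bigD1 k)//= -expr2 lerDl.
  by apply: sumr_ge0 => l _; rewrite -expr2 sqr_ge0.
have := le_sq i; have := le_sq j.
by move=> ? ?; rewrite ler_norml; apply/andP; split; nra.
Qed.

(** Cauchy-Schwarz for [u] and [invmx B *m u] bounds [(u, u)^2] by [(B u, u) (B^-1 u, u)], and the
    form of the inverse is bounded. *)
Lemma psd_unit_coercive m (B : 'M[R]_m) : psd B -> B \in unitmx ->
  exists2 K : R, 0 < K & forall u, dotc u u <= K * dotc (B *m u) u.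
Proof.
move=> pB uB; have [K K0 hK] := dotc_bounded (invmx B); exists K => // u.
have [->|u0] := eqVneq u 0; first by rewrite dotc0r mulmx0 dotc0l mulr0.
have h := psd_cauchy u (invmx B *m u) pB.
have hu := dotc_gt0 u0.
rewrite (dotc_mull B u) pB.1 mulKVmx// in h.
rewrite [X in _ * X]dotcC in h.
have hi := hK u; have hb := pB.2 u.
rewrite -(ler_pM2l hu) -expr2; apply: (le_trans h).
apply: (le_trans (ler_wpM2l hb hi)).
by rewrite le_eqVlt; apply/orP; left; apply/eqP; ring.
Qed.

(** The infimum [lam] of all [s] with [B <= s C] as forms is the largest generalised eigenvalue: it
    exceeds [t] because of [x], and [lam C - B] is semidefinite and singular, so a kernel vector is
    an eigenvector. *)
Lemma gen_eigen_gt m (B C : 'M[R]_m) t (x : 'cV[R]_m) : B^T = B -> spd C ->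
  t * dotc (C *m x) x < dotc (B *m x) x ->
  exists lam v, gen_eigen B C v lam /\ t < lam.
Proof.
move=> sB sC hx.
have x0 : x != 0 by apply: contraTneq hx => ->; rewrite !dotc0r mulr0 ltxx.
pose S := [set s : R | forall u, dotc (B *m u) u <= s * dotc (C *m u) u].
have [K1 K10 hK1] := dotc_bounded B.
have [K2 K20 hK2] := dotc_bounded C.
have [K3 K30 hK3] := psd_unit_coercive (spd_psd sC) (spd_unit sC).
have S0 : S !=set0.
  by exists (K1 * K3) => u; rewrite -mulrA (le_trans (hK1 u))// ler_wpM2l// ltW.
have Cx := sC.2 x x0.
have lbS : lbound S (dotc (B *m x) x / dotc (C *m x) x).
  by move=> s Ss; rewrite ler_pdivrMr//; apply: Ss.
have hlbS : has_lbound S by exists (dotc (B *m x) x / dotc (C *m x) x).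
set lam := inf S.
have lam_t : t < lam.
  by apply: lt_le_trans (lb_le_inf S0 lbS); rewrite ltr_pdivlMr.
have Slam : S lam.
  move=> u; have [->|u0] := eqVneq u 0; first by rewrite !dotc0r mulr0.
  have Cu := sC.2 u u0.
  rewrite -ler_pdivrMr//; apply: lb_le_inf => // s Ss.
  by rewrite ler_pdivrMr//; apply: Ss.
pose P := lam *: C - B.
have PE u : dotc (P *m u) u = lam * dotc (C *m u) u - dotc (B *m u) u.
  by rewrite /P mulmxBl dotcDl dotcNl -scalemxAl dotcZl.
have pP : psd P.
  split=> [|u]; last by rewrite PE subr_ge0; apply: Slam.
  by rewrite /P linearB linearZ/= sB sC.1.
(* Were lam C - B invertible, it would be coercive and lam could be lowered. *)
have [uP|nuP] := boolP (P \in unitmx).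
  have [K K0 hK] := psd_unit_coercive pP uP.
  (* The slack comes from [(C u, u) <= K2 (u, u) <= K2 K (P u, u)]. *)
  suff : S (lam - (K * K2)^-1).
    move=> /(ge_inf hlbS); rewrite -/lam lerDl oppr_ge0 invr_le0 leNgt.
    by rewrite mulr_gt0.
  move=> u; rewrite mulrBl; have h := hK u; rewrite PE in h.
  suff : (K * K2)^-1 * dotc (C *m u) u
           <= lam * dotc (C *m u) u - dotc (B *m u) u by lra.
  rewrite ler_pdivrMl ?mulr_gt0// mulrAC mulrC.
  by apply: (le_trans (hK2 u)); rewrite ler_wpM2l// ltW.
exists lam; move: nuP; rewrite -row_free_unit -kermx_eq0.
move=> /rowV0Pn[v /sub_kermxP vP v0]; exists v^T; split=> //; split.
  by rewrite trmx_eq0.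
apply/eqP; rewrite eq_sym -subr_eq0 scalemxAl -mulmxBl -/P.
by rewrite -pP.1 -trmx_mul vP trmx0.
Qed.

End dotc_theory.

(** * Generalised eigenvectors above a threshold *)

Section gen_eigen_split.
Context {R : realType} {m : nat}.
Variables (B C : 'M[R]_m) (t : R).
Hypotheses (sB : B^T = B) (sC : spd C) (t_ge0 : 0 <= t).

(** The columns of [Y] are eigenvectors above [t]; being [C]-orthonormal they are independent, so
    [p <= m] and a maximal family exists. *)
Let family p := exists (Y : 'M[R]_(m, p)) (L : 'rV[R]_p),
  [/\ Y^T *m C *m Y = 1%:M, B *m Y = C *m Y *m diag_mx L &
      forall j, t < L 0 j].

Let family_le p : family p -> (p <= m)%N.
Proof.
move=> [Y [L [YCY _ _]]]; rewrite -(mxrank1 R p) -YCY -mulmxA.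
by apply: leq_trans (mxrankM_maxl _ _) _; rewrite rank_leq_col.
Qed.

Let family_extend p (Y : 'M[R]_(m, p)) (L : 'rV[R]_p) v lam :
  [/\ Y^T *m C *m Y = 1%:M, B *m Y = C *m Y *m diag_mx L &
      forall j, t < L 0 j] ->
  gen_eigen B C v lam -> t < lam -> Y^T *m C *m v = 0 -> family (p + 1).
Proof.
move=> [YCY BY tL] [v0 Bv] tlam YCv.
have Cv := sC.2 v v0.
pose w := (Num.sqrt (dotc (C *m v) v))^-1 *: v.
have wCw : w^T *m C *m w = 1%:M.
  apply/matrixP => i j; rewrite !ord1 [RHS]mxE eqxx.
  transitivity (dotc (C *m w) w); first by rewrite /dotc trmx_mul sC.1.
  by rewrite quadZ exprVn sqr_sqrtr ?ltW// mulVf ?gt_eqF.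
have YCw : Y^T *m C *m w = 0 by rewrite -scalemxAr YCv scaler0.
have wCY : w^T *m C *m Y = 0.
  by apply: trmx_inj; rewrite !trmx_mul trmxK sC.1 mulmxA YCw trmx0.
have Bw : B *m w = C *m w *m lam%:M.
  by rewrite -scalemxAr Bv -scalemxAr mul_mx_scalar scalerA mulrC -scalerA.
exists (row_mx Y w), (row_mx L (const_mx lam)); split.
- rewrite tr_row_mx mul_col_mx mul_col_row YCY YCw wCY wCw.
  by rewrite -scalar_mx_block.
- rewrite !mul_mx_row diag_mx_row diag_const_mx mul_row_block.
  by rewrite !mulmx0 addr0 add0r BY Bw.
- move=> j; rewrite mxE; case: splitP => k _; first exact: tL.
  by rewrite mxE.
Qed.

(** A maximal family above [t] serves instead of a full eigenbasis. In the application [u - F *m u]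
    is absorbed by the coarse space and [F *m u] is the stable part. *)
Lemma gen_eigen_split : exists F : 'M[R]_m,
  (forall u, exists k (w : 'I_k -> 'cV[R]_m),
     (forall j, exists2 lam, gen_eigen B C (w j) lam & t < lam) /\
     exists c : 'I_k -> R, u - F *m u = \sum_j c j *: w j) /\
  (forall u, dotc (B *m (F *m u)) (F *m u) <= t * dotc (C *m u) u).
Proof.
have fam0 : `[< family 0 >].
  apply/asboolP; exists 0, 0; split; first by rewrite !flatmx0.
    by rewrite !thinmx0.
  by case.
have famle p : `[< family p >] -> (p <= m)%N by move=> /asboolP/family_le.
case: (ex_maxnP (ex_intro _ 0%N fam0) famle) => p /asboolP[Y [L fY]] pmax.
have [YCY BY tL] := fY.
(* F is the C-orthogonal projection along the eigenvectors in Y; an eigenvector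
   above t of F^T B F would be one of B and would extend the maximal family. *)
pose F : 'M[R]_m := 1%:M - Y *m Y^T *m C.
have FY : F *m Y = 0.
  by rewrite mulmxBl mul1mx -!mulmxA [Y^T *m _]mulmxA YCY mulmx1 subrr.
exists F; split=> u.
  exists p, (fun j => col j Y); split.
    move=> j; exists (L 0 j) => //; split.
      apply/eqP => Yj; have /matrixP/(_ j j) := YCY.
      rewrite [RHS]mxE eqxx mxE => /eqP; rewrite big1 ?(eq_sym 0) ?oner_eq0//.
      move=> k _; have /colP/(_ k) := Yj.
      by rewrite !mxE => ->; rewrite mulr0.
    rewrite colE !mulmxA BY -!colE mul_mx_diag.
    by apply/colP => i; rewrite !mxE mulrC.
  exists (fun j => (Y^T *m C *m u) j 0).
  rewrite mulmxBl mul1mx opprB addrC subrK -!mulmxA.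
  apply/colP => i; rewrite mxE summxE; apply: eq_bigr => j _.
  by rewrite !mxE mulrC.
rewrite leNgt; apply/negP => hu.
have hu' : t * dotc (C *m u) u < dotc (F^T *m B *m F *m u) u.
  by rewrite quad_congruence.
have [lam [v [[v0 Bv] tlam]]] := gen_eigen_gt (congruence_sym F sB) sC hu'.
(* Multiplying the eigenvalue equation of [F^T B F] by [Y^T] kills its left side, as [F Y = 0]; and
   [lam] is nonzero since [lam > t >= 0]. *)
have YCv : Y^T *m C *m v = 0.
  have : lam *: (Y^T *m C *m v) = 0.
    rewrite -mulmxA scalemxAr -Bv !mulmxA -trmx_mul FY trmx0.
    by rewrite !mul0mx.
  by move/eqP; rewrite scaler_eq0 (gt_eqF (le_lt_trans t_ge0 tlam)) => /eqP.
have Fv : F *m v = v.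
  by rewrite mulmxBl mul1mx -!mulmxA [Y^T *m _]mulmxA YCv mulmx0 subr0.
have YB : Y^T *m B = diag_mx L *m Y^T *m C.
  by rewrite -[B in LHS]sB -trmx_mul BY !trmx_mul tr_diag_mx sC.1 mulmxA.
(* [Y^T B v] is a diagonal multiple of [Y^T C v = 0], so [F^T = 1 - C Y Y^T] fixes [B v]. *)
have Bv' : B *m v = lam *: (C *m v).
  rewrite -Bv -!mulmxA Fv linearB/= trmx1 mulmxBl mul1mx.
  rewrite !trmx_mul trmxK sC.1 -!mulmxA [Y^T *m _]mulmxA YB -!mulmxA.
  by rewrite [Y^T *m _]mulmxA YCv !mulmx0 subr0.
have := family_extend fY (conj v0 Bv') tlam YCv.
by move=> /asboolP/pmax; rewrite addn1 ltnn.
Qed.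

End gen_eigen_split.

(** * The Schwarz operator *)

Section schwarz.
Context {R : realType} {n N : nat}.
Variables (d : 'I_N -> nat) (A : 'M[R]_n) (Rs : forall i, 'M[R]_(d i, n)).
Hypothesis A_spd : spd A.

Let B i := Rs i *m A *m (Rs i)^T.
Hypothesis B_spd : forall i, spd (B i).

Let r (u : 'cV[R]_n) i := Rs i *m (A *m u).
Let s u := \sum_i dotc (r u i) (invmx (B i) *m r u i).

(** Young's inequality in each [B i], for [invmx (B i) *m r u i] and [w i] with parameter [c], sums
    to [2 c a <= c^2 s + c a], where [a] is the energy of [u]. *)
Lemma schwarz_lower (c : R) u (w : forall i, 'cV[R]_(d i)) : 0 < c ->
  dotc (A *m u) u = \sum_i dotc (r u i) (w i) ->
  \sum_i dotc (B i *m w i) (w i) <= c * dotc (A *m u) u ->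
  dotc (A *m u) u <= c * s u.
Proof.
move=> c0 au hw.
have : 2 * c * dotc (A *m u) u <=
       c ^+ 2 * s u + \sum_i dotc (B i *m w i) (w i).
  rewrite {1}au /s !mulr_sumr -big_split; apply: ler_sum => i _ /=.
  have := psd_young c (invmx (B i) *m r u i) (w i) (spd_psd (B_spd i)).
  by rewrite mulKVmx// spd_unit.
move=> h; have : c * dotc (A *m u) u <= c * (c * s u) by lra.
by rewrite ler_pM2l.
Qed.

(** A cross term is at most half the sum of its two diagonal terms, and each index takes part in
    nonzero products with at most [k] indices. *)
Lemma quad_sum_le (k : nat) (x : 'I_N -> 'cV[R]_n) :
  (forall i, #|[set j | dotc (A *m x i) (x j) != 0%R]%SET| <= k)%N ->
  dotc (A *m \sum_i x i) (\sum_i x i) <= k%:R * \sum_i dotc (A *m x i) (x i).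
Proof.
move=> hk; pose q i := dotc (A *m x i) (x i).
pose e i j := (dotc (A *m x i) (x j) != 0)%:R : R.
have eC i j : e i j = e j i by rewrite /e dotc_sym ?A_spd.1.
have eE i : \sum_j e i j <= k%:R.
  rewrite /e -natr_sum ler_nat; apply: leq_trans (hk i).
  by rewrite -sum1dep_card [leqRHS]big_mkcond leq_sum// => j _; case: eqP.
have q0 i : 0 <= q i by exact: (spd_psd A_spd).2.
have -> : dotc (A *m \sum_i x i) (\sum_i x i)
            = \sum_i \sum_j dotc (A *m x i) (x j).
  rewrite mulmx_sumr dotc_suml; apply: eq_bigr => i _.
  by rewrite dotc_sumr.
have h i j : dotc (A *m x i) (x j) <= 2^-1 * (e i j * q i + e i j * q j).
  rewrite /e; have [->|_] := eqVneq; first by rewrite !mul0r addr0 mulr0.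
  have := psd_young 1 (x i) (x j) (spd_psd A_spd).
  by rewrite !mul1r mulr1 expr1n mul1r -/(q i) -/(q j) => ?; lra.
have le1 : \sum_i \sum_j e i j * q i <= k%:R * \sum_i q i.
  rewrite mulr_sumr ler_sum// => i _.
  by rewrite -mulr_suml ler_wpM2r.
have le2 : \sum_i \sum_j e i j * q j <= k%:R * \sum_i q i.
  rewrite exchange_big; apply: le_trans le1.
  by apply: ler_sum => i _; apply: ler_sum => j _; rewrite eC.
apply: (@le_trans _ _ (2^-1 * (\sum_i \sum_j e i j * q i
                               + \sum_i \sum_j e i j * q j))); last by lra.
rewrite -big_split mulr_sumr; apply: ler_sum => i _ /=.
by rewrite -big_split mulr_sumr; apply: ler_sum.
Qed.

(** With [x i] the local corrections, [s u] is both the product of [u] with their sum and the sum of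
    their energies; Young with parameter [k] then gives [2 k s <= k^2 a + k s], where [a] is the
    energy of [u]. *)
Lemma schwarz_upper (k : nat) u : (0 < k)%N ->
  (forall i, #|[set j | Rs j *m A *m (Rs i)^T != 0%R]%SET| <= k)%N ->
  s u <= k%:R * dotc (A *m u) u.
Proof.
move=> k0 hk; pose w i := invmx (B i) *m r u i.
pose x i := (Rs i)^T *m w i.
have hx i : (#|[set j | dotc (A *m x i) (x j) != 0%R]%SET| <= k)%N.
  apply: leq_trans (hk i); apply/subset_leq_card/fintype.subsetP => j.
  rewrite !inE; apply: contraNN => /eqP h.
  by rewrite /x [dotc _ _]dotcC dotc_mull trmxK !mulmxA h !mul0mx dotc0r.
have qx i : dotc (A *m x i) (x i) = dotc (r u i) (w i).
  rewrite /x dotcC dotc_mull trmxK [w i]lock !mulmxA -/(B i) -lock.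
  by rewrite /w mulKVmx ?spd_unit// dotcC.
have sx : s u = dotc (A *m u) (\sum_i x i).
  by rewrite dotc_sumr; apply: eq_bigr => i _; rewrite [LHS]dotc_mull.
have h1 := quad_sum_le hx.
have h2 := psd_young k%:R u (\sum_i x i) (spd_psd A_spd).
rewrite (eq_bigr _ (fun i _ => qx i)) -/(s u) in h1; rewrite -sx in h2.
have k0' : (0 : R) < k%:R by rewrite ltr0n.
have : k%:R * s u <= k%:R * (k%:R * dotc (A *m u) u) by lra.
by rewrite ler_pM2l.
Qed.

End schwarz.

(** * Eigenvalues of the two-level preconditioned matrix *)

Section two_level.
Context {R : realType} {n N : nat}.
Variables (A : 'M[R]_n) (I : 'I_N -> {set 'I_n}).
Hypothesis A_spd : spd A.

Lemma restrK (J : {set 'I_n}) : restr R J *m (restr R J)^T = 1%:M.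
Proof.
apply/matrixP => i j; rewrite !mxE (bigD1 (enum_val i))//= !mxE eqxx mul1r.
rewrite big1 => [|k ki]; last by rewrite !mxE eq_sym (negPf ki) mul0r.
by rewrite addr0 (inj_eq enum_val_inj) eq_sym.
Qed.

Lemma local_mx_spd (J : {set 'I_n}) : spd (local_mx A J).
Proof.
split; first by rewrite /local_mx !trmx_mul trmxK A_spd.1 mulmxA.
move=> u u0; rewrite /local_mx -!mulmxA dotc_mull; apply: A_spd.2.
apply: contraNneq u0 => h.
by rewrite -[u]mul1mx -(restrK J) -mulmxA h mulmx0.
Qed.

Lemma coarse_spd m (Z : 'M[R]_(n, m)) : row_free Z^T -> spd (Z^T *m A *m Z).
Proof.
move=> fZ; split; first exact: congruence_sym A_spd.1.
move=> u u0; rewrite -!mulmxA dotc_mull trmxK; apply: A_spd.2.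
apply: contra_neq u0 => Zu; apply: trmx_inj; apply: (row_free_inj fZ).
by rewrite -trmx_mul Zu !trmx0 mul0mx.
Qed.

Lemma two_level_eigenvalue m (Z : 'M[R]_(n, m)) (k : nat) (c lam : R) :
  row_free Z^T -> (0 < k)%N -> 1 <= c ->
  (forall i, #|[set j | restr R (I j) *m A *m (restr R (I i))^T != 0%R]%SET|
             <= k)%N ->
  (forall u, exists z (w : forall i, 'cV[R]_#|I i|),
     u = Z *m z + \sum_i (restr R (I i))^T *m w i /\
     \sum_i dotc (local_mx A (I i) *m w i) (w i) <= c * dotc (A *m u) u) ->
  eigenvalue (M_AS2_inv A I Z *m A) lam -> c^-1 <= lam <= k%:R.
Proof.
move=> fZ k0 c1 hk hdec /eigenvalueP[v vM v0].
have sZ := coarse_spd fZ.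
set P := P_0 A Z.
(* [eigenvalue] refers to left eigenvectors: [v M^-1 A = lam v]. With [A u = v^T] this yields the
   Rayleigh identity [lam (A u, u) = (A u, M^-1 A u)]. *)
have [u Au] : exists u, A *m u = v^T.
  by exists (invmx A *m v^T); rewrite mulKVmx// spd_unit.
have u0 : u != 0.
  by apply: contraNneq v0 => u0; rewrite -trmx_eq0 -Au u0 mulmx0.
have au := A_spd.2 u u0.
set K := invmx (Z^T *m A *m Z).
have sK : K^T = K by rewrite /K trmx_inv sZ.1.
have PZ : P *m Z = Z.
  by rewrite /P /P_0 -[RHS]mulmx1 -!mulmxA [Z^T *m _]mulmxA mulVmx// spd_unit.
have PE : P = Z *m (K *m (Z^T *m A)) by rewrite /P /P_0 !mulmxA.
have PP : P *m P = P by rewrite {2}PE mulmxA PZ -PE.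
(* Together with [PP], this makes [P] the [A]-orthogonal projection onto the range of [Z], so
   energies split. *)
have PA : P^T *m A = A *m P.
  by rewrite /P /P_0 !trmx_mul trmxK A_spd.1 sK !mulmxA.
have ZKZ : Z *m K *m Z^T *m (A *m u) = P *m u by rewrite !mulmxA.
pose u' := u - P *m u.
have Pu' : P *m u' = 0 by rewrite mulmxBr mulmxA PP subrr.
have Au' : (1%:M - P^T) *m (A *m u) = A *m u'.
  by rewrite mulmxBl mul1mx mulmxA PA -mulmxA -mulmxBr.
have cross : dotc (A *m (P *m u)) u' = 0.
  by rewrite mulmxA -PA -mulmxA dotc_mull trmxK Pu' dotc0r.
have a_split : dotc (A *m u) u
    = dotc (A *m (P *m u)) (P *m u) + dotc (A *m u') u'.
  rewrite -{1 2}(subrK (P *m u) u) -/u' quadD ?A_spd.1//.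
  by rewrite (dotc_sym _ _ A_spd.1) cross mulr0 addr0 addrC.
pose s := \sum_i dotc (restr R (I i) *m (A *m u'))
             (invmx (local_mx A (I i)) *m (restr R (I i) *m (A *m u'))).
have lamE : lam * dotc (A *m u) u = dotc (A *m (P *m u)) (P *m u) + s.
  have -> : lam * dotc (A *m u) u
      = dotc (A *m u) (M_AS2_inv A I Z *m (A *m u)).
    rewrite -dotcZl Au.
    transitivity (dotc ((M_AS2_inv A I Z *m A)^T *m v^T) u).
      by rewrite -trmx_mul vM linearZ.
    by rewrite dotc_mull trmxK -mulmxA Au.
  rewrite /M_AS2_inv -/K mulmxDl ZKZ dotcDr; congr (_ + _).
    rewrite -{1}(subrK (P *m u) u) -/u' mulmxDr dotcDl.
    by rewrite (dotc_sym _ _ A_spd.1) cross add0r.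
  rewrite -!mulmxA -/P Au' dotcC dotc_mull [(_ - _)^T]linearB/= trmx1 Au'.
  rewrite mulmx_suml dotc_suml; apply: eq_bigr => i _.
  by rewrite -!mulmxA dotc_mull trmxK dotcC.
have a0 : 0 <= dotc (A *m (P *m u)) (P *m u) by exact: (spd_psd A_spd).2.
have a'0 : 0 <= dotc (A *m u') u' by exact: (spd_psd A_spd).2.
have B_spd i := local_mx_spd (I i).
have s_le : s <= k%:R * dotc (A *m u') u' := schwarz_upper A_spd B_spd u' k0 hk.
have c0 : 0 < c by lra.
have s_ge : dotc (A *m u') u' <= c * s.
  (* The decomposition is that of [u'], not of [u]: its coarse term drops out because [A u'] is
     orthogonal to the range of [Z]. *)
  have [z [w [u'E hw]]] := hdec u'.
  apply: (schwarz_lower B_spd c0 _ hw).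
  rewrite {2}u'E dotcDr [X in X + _](_ : _ = 0) ?add0r.
    by rewrite dotc_sumr; apply: eq_bigr => i _; rewrite [RHS]dotc_mull.
  have -> : A *m u' = (1%:M - P^T) *m (A *m u') by
    rewrite mulmxBl mul1mx [P^T *m _]mulmxA PA -mulmxA Pu' mulmx0 subr0.
  rewrite dotc_mull [(_ - _)^T]linearB/= trmx1 trmxK mulmxBl mul1mx mulmxA PZ.
  by rewrite subrr dotc0r.
have k1 : (1 : R) <= k%:R by rewrite ler1n.
(* The coarse energy enters with factor 1, which lies between [c^-1] and [k]. *)
apply/andP; split.
  rewrite -(ler_pM2r au) lamE ler_pdivrMl// a_split mulrDr.
  apply: lerD => //; nra.
rewrite -(ler_pM2r au) lamE a_split mulrDr; apply: lerD => //; nra.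
Qed.

Lemma cond_le (B : 'M[R]_n) (k c : R) : 0 < c -> 0 <= k ->
  (forall lam, eigenvalue B lam -> c^-1 <= lam <= k) -> cond B <= c * k.
Proof.
move=> c0 k0 h; rewrite /cond; set E := [set x | _].
(* Without eigenvalues, [sup set0 = 0] makes [cond B] equal to 0. *)
have [->|/set0P E0] := eqVneq E set0.
  by rewrite sup0 mul0r mulr_ge0// ltW.
have supE : sup E <= k by apply: sup_le_ub => // x /h/andP[].
have infE : c^-1 <= inf E by apply: lb_le_inf => // x /h/andP[].
have infE0 : 0 < inf E by apply: lt_le_trans infE; rewrite invr_gt0.
rewrite ler_pdivrMr// mulrAC; apply: (le_trans supE).
by rewrite ler_peMl// mulrC -ler_pdivrMr// div1r.
Qed.

End two_level.

(** * Lebesgue measure on three-dimensional space *)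

Section lebesgue3.
Context {R : realType}.

Lemma ball3E (x : R3 R) e :
  ball x e = (ball x.1.1 e `*` ball x.1.2 e) `*` ball x.2 e.
Proof. by apply/seteqP; split=> y [[]]. Qed.

Lemma measurable_ball3 (x : R3 R) e : measurable (ball x e : set (mR3 R)).
Proof.
rewrite ball3E; apply: measurableX; last exact: measurable_ball.
by apply: measurableX; exact: measurable_ball.
Qed.

(** Reconciles the topology with the product sigma-algebra: an open set is the union of the
    countably many balls inside it with rational centre and radius [1 / (k + 1)], and these are
    boxes. *)
Lemma open_measurable3 (U : set (R3 R)) :
  open U -> measurable (U : set (mR3 R)).
Proof.
move=> oU.
pose q3 (i : rat * rat * rat) : R3 R := (ratr i.1.1, ratr i.1.2, ratr i.2).
pose F (i : rat * rat * rat * nat) : set (mR3 R) :=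
  if `[< ball (q3 i.1) i.2.+1%:R^-1 `<=` U >]
  then ball (q3 i.1) i.2.+1%:R^-1 else set0.
suff -> : U = \bigcup_i F i.
  apply: countable_bigcupT_measurable => [|i]; first exact: countableP.
  by rewrite /F; case: ifP => // _; exact: measurable_ball3.
apply/seteqP; split=> [x Ux|x [i _]]; last first.
  by rewrite /F; case: asboolP => // h; exact: h.
have /nbhs_ballP[e /= e0 xeU] : nbhs x U by exact: open_nbhs_nbhs.
(* A ball of radius below [e / 2] that contains [x] stays inside [ball x e]. *)
have [k] : exists k, 0 + k.+1%:R^-1 < e / 2 by exact/ltr_add_invr/divr_gt0.
rewrite add0r => ke.
have k0 : (0 : R) < k.+1%:R^-1 by [].
have rat_near (y : R) : exists q : rat, `|ratr q - y| < k.+1%:R^-1.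
  have [q] : exists q : rat, ratr q \in `]y - k.+1%:R^-1, y + k.+1%:R^-1[.
    by apply: rat_in_itvoo; rewrite ltrBlDr -addrA ltrDl addr_gt0.
  by rewrite in_itv/= => qy; exists q; rewrite ltr_distl.
have [q1 h1] := rat_near x.1.1.
have [q2 h2] := rat_near x.1.2.
have [q3' h3] := rat_near x.2.
have xq : ball (q3 (q1, q2, q3')) k.+1%:R^-1 x by split; [split|].
exists (q1, q2, q3', k) => //; rewrite /F; case: asboolP => //= -[].
move=> y qy; apply: xeU; rewrite (splitr e).
apply: ball_triangle (le_ball (ltW ke) qy).
exact: ball_sym (le_ball (ltW ke) xq).
Qed.

Lemma closed_measurable3 (U : set (R3 R)) :
  closed U -> measurable (U : set (mR3 R)).
Proof.
by move=> /closed_openC/open_measurable3/measurableC; rewrite setCK.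
Qed.

(** Balls of the product are cubes of side [2 e], whose measure is a product of three lengths. *)
Lemma leb3_open_gt0 (U : set (R3 R)) : open U -> U !=set0 -> (0 < leb3 R U)%E.
Proof.
move=> oU [x Ux].
have /nbhs_ballP[e /= e0 xeU] : nbhs x U by exact: open_nbhs_nbhs.
apply: (@lt_le_trans _ _ (leb3 R (ball x e))); last first.
  by apply: le_measure => //; rewrite inE;
    [exact: measurable_ball3|exact: open_measurable3].
pose L : {sigma_finite_measure set measurableTypeR R -> \bar R} :=
  @lebesgue_measure R.
have mb (y : R) : measurable (ball y e : set (measurableTypeR R)).
  exact: measurable_ball.
have -> : leb3 R (ball x e) =
    (L (ball x.1.1 e) * L (ball x.1.2 e) * L (ball x.2 e))%E.
  rewrite ball3E -(@product_measure1E _ _ _ _ _ L L)//.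
  by apply: product_measure1E => //; apply: measurableX.
have Lb (y : R) : L (ball y e) = (e *+ 2)%:E.
  by rewrite -(lebesgue_measure_ball y (ltW e0)).
rewrite !Lb -!EFinM lte_fin.
by rewrite !mulr_gt0// mulrn_wgt0.
Qed.

End lebesgue3.

(** * Pointwise products and integrability of the integrand *)

Section form_theory.
Context {R : realType}.

Lemma dotrC (u v : 'rV[R]_3) : dotr u v = dotr v u.
Proof. by rewrite /dotr; apply: eq_bigr => j _; rewrite mulrC. Qed.

Lemma dotr_ge0 (u : 'rV[R]_3) : 0 <= dotr u u.
Proof. by rewrite /dotr sumr_ge0// => j _; rewrite -expr2 sqr_ge0. Qed.

Lemma dotr0l (u : 'rV[R]_3) : dotr 0 u = 0.
Proof. by rewrite /dotr big1// => j _; rewrite mxE mul0r. Qed.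

Lemma dotr0r (u : 'rV[R]_3) : dotr u 0 = 0.
Proof. by rewrite dotrC dotr0l. Qed.

(** Exhibits the double sum as a square; this is what makes the energy density nonnegative. *)
Lemma dotr_lincomb n (c : 'I_n -> R) (w : 'I_n -> 'rV[R]_3) :
  \sum_k \sum_l c k * c l * dotr (w l) (w k) =
  dotr (\sum_k c k *: w k) (\sum_k c k *: w k).
Proof.
rewrite {2}/dotr.
transitivity (\sum_k \sum_l \sum_(j < 3) (c l * w l 0 j) * (c k * w k 0 j)).
  apply: eq_bigr => k _; apply: eq_bigr => l _; rewrite mulr_sumr.
  by apply: eq_bigr => j _; ring.
under eq_bigr do rewrite exchange_big.
rewrite exchange_big; apply: eq_bigr => j _ /=.
rewrite summxE; under eq_bigr do rewrite -mulr_suml.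
rewrite -mulr_sumr; congr (_ * _); apply: eq_bigr => k _; by rewrite mxE.
Qed.

Lemma coefficient_inv (Om : set (R3 R)) f :
  coefficient Om f -> coefficient Om (fun x => (f x)^-1).
Proof.
move=> [mf [c [C [c0 cfC]]]].
split; last first.
  (* On an empty [Om] the bound [C] could be nonpositive; the maximum with [c] keeps the new lower
     bound positive. *)
  exists (Num.max C c)^-1, c^-1; rewrite invr_gt0 lt_max c0 orbT; split=> // x.
  move=> /cfC/andP[cf fC].
  by rewrite !lef_pV2 ?posrE ?lt_max ?c0 ?orbT ?le_max ?fC//; lra.
apply: (@eq_measurable_fun _ _ _ _ _ (fun x => (f x) `^ (-1))).
  by move=> x /set_mem/cfC/andP[cf _]; rewrite powR_inv1//; lra.
exact: (measurableT_comp (measurable_powR (-1)) mf).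
Qed.

(** Domination by [C] times the sum of all squared components, from [|p q| <= p^2 + q^2]. *)
Lemma integrable_weighted_dot (Om : set (R3 R)) (a : R3 R -> R) u v :
  measurable (Om : set (mR3 R)) -> coefficient Om a ->
  L2_field Om u -> L2_field Om v ->
  (leb3 R).-integrable Om (fun x => (a x * dotr (u x) (v x))%:E).
Proof.
move=> mOm [ma [c [C [c0 caC]]]] L2u L2v.
apply: (@le_integrable _ (mR3 R) R (leb3 R) Om mOm _
  (fun x => C%:E * \sum_(j < 3) ((u x 0 j ^+ 2)%:E + (v x 0 j ^+ 2)%:E))%E).
- apply/measurable_EFinP; apply: measurable_realfun.measurable_funM => //.
  apply: measurable_sum => j.
  by apply: measurable_realfun.measurable_funM; [case: (L2u j)|case: (L2v j)].
- move=> x /caC/andP[ca aC].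
  under eq_bigr do rewrite -EFinD.
  rewrite sumEFin -EFinM/= lee_fin [leRHS]ger0_norm ?normrM; last first.
    apply: mulr_ge0; first lra.
    by apply: sumr_ge0 => j _; rewrite addr_ge0// sqr_ge0.
  apply: ler_pM => //; first by rewrite ger0_norm; lra.
  apply: (le_trans (ler_norm_sum _ _ _)); apply: ler_sum => j _.
  by rewrite ler_norml; apply/andP; split; nra.
apply: integrableZl => //; apply: integrable_sum => // j _.
by apply: integrableD => //; [case: (L2u j)|case: (L2v j)].
Qed.

End form_theory.

(** * Finite overlap of the subdomain forms *)

Lemma Rintegral_sum d (T : measurableType d) (R : realType)
    (nu : {measure set T -> \bar R}) (D : set T) (J : Type) (r : seq J)
    (f : J -> T -> R) :
  measurable D -> (forall j, nu.-integrable D (EFin \o f j)) ->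
  Rintegral nu D (fun x => \sum_(j <- r) f j x) =
  \sum_(j <- r) Rintegral nu D (f j).
Proof.
move=> mD fD; rewrite /Rintegral.
under eq_integral do rewrite -sumEFin.
rewrite integral_sum// -sum_fine// => j _.
exact: (integrable_fin_num mD (fD j)).
Qed.

(** The left side integrates [f] times the number of sets [E i] containing the point, and that
    number exceeds [k] only on a finite union of null intersections. *)
Lemma overlap_Rintegral d (T : measurableType d) (R : realType)
    (nu : {measure set T -> \bar R}) (N : nat) (D : set T)
    (E : 'I_N -> set T) (f : T -> R) (k : nat) :
  measurable D -> (forall i, measurable (E i)) -> (forall i, E i `<=` D) ->
  (forall J : {set 'I_N}, nu (\bigcap_(i in [set` J]) E i) != 0%E ->
     (#|J| <= k)%N) ->
  nu.-integrable D (EFin \o f) -> (forall x, D x -> 0 <= f x) ->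
  \sum_i Rintegral nu (E i) f <= k%:R * Rintegral nu D f.
Proof.
move=> mD mE ED hk fD f0.
have fE i : nu.-integrable D (EFin \o (f \_ (E i))).
  rewrite -restrict_EFin; apply: (integrableS measurableT) => //.
  by apply/(integrable_mkcond _ (mE i)); exact: integrableS fD.
have -> : \sum_i Rintegral nu (E i) f
    = Rintegral nu D (fun x => \sum_i (f \_ (E i)) x).
  rewrite Rintegral_sum//; apply: eq_bigr => i _.
  by rewrite -Rintegral_mkcondr setIidr.
rewrite -RintegralZl//.
have kf : nu.-integrable D (EFin \o (fun x => k%:R * f x)).
  rewrite (_ : _ \o _ = fun x => (k%:R%:E * (f x)%:E)%E); last exact/funext.
  exact: integrableZl.
have sf : nu.-integrable D (EFin \o (fun x => \sum_i (f \_ (E i)) x)).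
  rewrite (_ : _ \o _ = fun x => (\sum_i ((f \_ (E i)) x)%:E)%E).
    by apply: integrable_sum => // i _; exact: fE.
  by apply/funext => x /=; rewrite sumEFin.
have ffE i x : D x -> 0 <= (f \_ (E i)) x.
  by move=> Dx; rewrite patchE; case: ifP => // _; exact: f0.
apply: fine_le (integrable_fin_num mD sf) (integrable_fin_num mD kf) _.
apply: ae_ge0_le_integral => //.
- by move=> x Dx; rewrite lee_fin sumr_ge0// => i _; exact: ffE.
- exact: measurable_int sf.
- by move=> x Dx; rewrite lee_fin mulr_ge0// f0.
- exact: measurable_int kf.
have null (J : {set 'I_N}) :
    {ae nu, forall x, (\bigcap_(i in [set` J]) E i) x -> (#|J| <= k)%N}.
  have [Jk|kJ] := leqP #|J| k; first exact: aeW.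
  have mJ : measurable (\bigcap_(i in [set` J]) E i).
    by apply: fin_bigcap_measurable => //; exact: finite_finset.
  apply: (@negligibleS _ _ _ _ (\bigcap_(i in [set` J]) E i)).
    by move=> x /=; apply: contra_notP => nJ /nJ.
  apply/negligibleP => //; apply/eqP; apply: contraT => /(hk J).
  by rewrite leqNgt kJ.
(* There are finitely many [J], so off a single null set the bound holds for all of them, in
   particular for the set of all [i] with [x] in [E i]. *)
have := filter_forall (ae_filter_ringOfSetsType nu) null.
apply: filterS => x hx Dx; rewrite lee_fin.
pose J := [set i : 'I_N | x \in E i]%SET.
have -> : \sum_i (f \_ (E i)) x = #|J|%:R * f x.
  rewrite -sum1dep_card natr_sum mulr_suml [RHS]big_mkcond/=.
  by apply: eq_bigr => i _; rewrite patchE; case: ifP => //; rewrite mul1r.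
rewrite ler_wpM2r ?f0// ler_nat; apply: hx => i /=.
by rewrite inE => /set_mem.
Qed.

(** * Stiffness and Neumann forms as integrals of one energy density *)

Section neumann_sum.
Context {R : realType} {M N n : nat}.
Variables (Om : set (R3 R)) (mu eps : R3 R -> R) (gamma : R).
Variables (K : 'I_M -> set (R3 R)) (phi : 'I_n -> R3 R -> 'rV[R]_3).
Variable (T : 'I_N -> {set 'I_M}).
Hypotheses (Om_dom : bounded_domain Om).
Hypotheses (mu_coef : coefficient Om mu) (eps_coef : coefficient Om eps).
Hypotheses (gamma_gt0 : 0 < gamma) (K_mesh : is_mesh Om K).
Hypothesis phi_basis : fe_basis Om K phi.

Let Omi i := subdomain Om K (T i).

Let mOm : measurable (Om : set (mR3 R)).
Proof. by apply: open_measurable3; case: Om_dom. Qed.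

Let K_measurable t : measurable (K t : set (mR3 R)).
Proof.
apply: closed_measurable3; apply: compact_closed; first exact: norm_hausdorff.
exact: mesh_compact K_mesh t.
Qed.

Let mOmi i : measurable (Omi i : set (mR3 R)).
Proof.
by apply: measurableI => //; apply: fin_bigcup_measurable.
Qed.

Let L2phi k : L2_field Om (phi k).
Proof. by case: (fe_conforming phi_basis k). Qed.

Let L2curl k : L2_field Om (curl (phi k)).
Proof. by case: (fe_conforming phi_basis k). Qed.

Let f k l x := (mu x)^-1 * dotr (curl (phi l) x) (curl (phi k) x)
  + gamma * eps x * dotr (phi l x) (phi k x).

Let f_int k l : (leb3 R).-integrable Om (EFin \o f k l).
Proof.
have -> : EFin \o f k l = ((fun x : mR3 R =>
      ((mu x)^-1 * dotr (curl (phi l) x) (curl (phi k) x))%:E)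
    \+ (fun x => gamma%:E * (eps x * dotr (phi l x) (phi k x))%:E))%E.
  by apply/funext => x /=; rewrite /f -EFinM -EFinD mulrA.
apply: integrableD => //.
  by apply: integrable_weighted_dot => //; exact: coefficient_inv.
by apply: integrableZl => //; exact: integrable_weighted_dot.
Qed.

(** Energy density of the field with coefficients [u]. The curls of the basis fields are combined
    after differentiation, so no derivative of a sum is taken on element faces. *)
Let quad (u : 'cV[R]_n) x := \sum_(k < n) \sum_(l < n) u k 0 * u l 0 * f k l x.

Let quad_sum_int (u : 'cV[R]_n) k :
  (leb3 R).-integrable Om
    (EFin \o (fun x : mR3 R => \sum_(l < n) u k 0 * u l 0 * f k l x)).
Proof.
rewrite (_ : _ \o _ =
    fun x : mR3 R => (\sum_l (u k 0 * u l 0)%R%:E * (f k l x)%:E)%E).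
  by apply: integrable_sum => // l _; apply: integrableZl => //; exact: f_int.
by apply/funext => x /=; rewrite -sumEFin.
Qed.

Let quad_int u : (leb3 R).-integrable Om (EFin \o quad u).
Proof.
rewrite (_ : _ \o _ = fun x : mR3 R =>
    (\sum_k (\sum_l u k 0 * u l 0 * f k l x)%R%:E)%E).
  by apply: integrable_sum => // k _; exact: quad_sum_int.
by apply/funext => x /=; rewrite -sumEFin.
Qed.

Let quad_ge0 u x : Om x -> 0 <= quad u x.
Proof.
move=> Omx; have -> : quad u x =
    (mu x)^-1 * dotr (\sum_k u k 0 *: curl (phi k) x)
                     (\sum_k u k 0 *: curl (phi k) x)
    + gamma * eps x * dotr (\sum_k u k 0 *: phi k x) (\sum_k u k 0 *: phi k x).
  rewrite -!dotr_lincomb !mulr_sumr -big_split; apply: eq_bigr => k _ /=.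
  rewrite !mulr_sumr -big_split; apply: eq_bigr => l _ /=.
  by rewrite /f; ring.
case: mu_coef eps_coef => _ [c1 [C1 [c10 h1]]] [_ [c2 [C2 [c20 h2]]]].
have /andP[mux _] := h1 x Omx; have /andP[epsx _] := h2 x Omx.
apply: addr_ge0; apply: mulr_ge0; rewrite ?dotr_ge0//.
  by rewrite invr_ge0 (le_trans (ltW c10) mux).
by rewrite mulr_ge0 ?(le_trans (ltW c20) epsx)// ltW.
Qed.

Let quad_Rintegral (S : set (R3 R)) u :
  measurable (S : set (mR3 R)) -> S `<=` Om ->
  Rintegral (leb3 R) S (quad u) =
  \sum_k \sum_l u k 0 * u l 0 * Defs.form mu eps gamma S (phi l) (phi k).
Proof.
move=> mS SOm.
rewrite Rintegral_sum// => [|k]; last exact: (integrableS mOm mS SOm).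
apply: eq_bigr => k _; rewrite Rintegral_sum// => [|l]; last first.
  apply: (integrableS mOm mS SOm).
  rewrite (_ : _ \o _ =
    fun x : mR3 R => ((u k 0 * u l 0)%R%:E * (f k l x)%:E)%E)//.
  by apply: integrableZl => //; exact: f_int.
apply: eq_bigr => l _; rewrite RintegralZl//.
exact: (integrableS mOm mS SOm).
Qed.

Lemma stiffness_sym :
  (stiffness mu eps gamma Om phi)^T = stiffness mu eps gamma Om phi.
Proof.
apply/matrixP => k l; rewrite !mxE /Defs.form; apply: eq_Rintegral => x _.
by rewrite [dotr (phi k x) _]dotrC [dotr (curl (phi k) x) _]dotrC.
Qed.

(* Inside an element phi_k is continuous, hence it vanishes there everywhere as
   soon as it does so almost everywhere, and then so does its curl. *)
Lemma phi_eq0 i k : k \notin dofs phi (Omi i) ->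
  {ae leb3 R, forall x, Omi i x -> phi k x = 0 /\ curl (phi k) x = 0}.
Proof.
rewrite inE => /asboolPn/contrapT phi0.
have int0 t x : t \in T i -> interior (K t) x -> phi k x = 0.
  move=> tT Kx; apply: contrapT => /eqP phix.
  have cphi : {for x, continuous (phi k)}.
    exact/differentiable_continuous/(fe_piecewise phi_basis k Kx).
  have nU : nbhs x (interior (K t) `&` [set y | phi k y != 0]).
    apply: filterI; first exact: open_nbhs_nbhs (conj (open_interior _) Kx).
    exact: (cvgr_neq0 _ cphi phix).
  pose U := interior (interior (K t) `&` [set y | phi k y != 0]).
  have oU : open U by exact: open_interior.
  have U0 : U !=set0 by exists x.
  have := leb3_open_gt0 oU U0; rewrite (measure_negligible _ _) ?ltxx//.
    exact: open_measurable3.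
  apply: negligibleS phi0 => y /interior_subset[Ky phiy] /= h.
  have : Omi i y.
    split; first exact: mesh_inside K_mesh _ _ Ky.
    by exists t => //; exact: interior_subset.
  by move=> /h /eqP; rewrite (negPf phiy).
have curl0 t x : t \in T i -> interior (K t) x -> curl (phi k) x = 0.
  move=> tT Kx; apply/rowP => j; rewrite !mxE.
  have d0 v l : 'D_v (fun y => phi k y 0 l) x = 0.
    rewrite (@near_eq_derive _ _ _ _ (cst 0)) ?derive_cst//.
    have : nbhs x (interior (K t)).
      exact: open_nbhs_nbhs (conj (open_interior _) Kx).
    by apply: filterS => y /(int0 _ _ tT) ->; rewrite mxE.
  by rewrite !d0 subrr.
(* Element boundaries are null, so almost every point of the subdomain is interior to one of its
   elements. *)
have bd0 t : {ae leb3 R, forall x, ~ (K t `\` interior (K t)) x}.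
  apply: (@negligibleS _ (mR3 R) R (leb3 R) (K t `\` interior (K t))).
    by move=> x /contrapT.
  apply/negligibleP; last exact: mesh_boundary K_mesh t.
  apply: measurableD; first exact: K_measurable.
  exact: (open_measurable3 (@open_interior _ (K t))).
have := filter_forall (ae_filter_ringOfSetsType (leb3 R)) bd0.
apply: filterS => x hx [Omx [t /= tT Ktx]].
have Kx : interior (K t) x by apply: contrapT => nKx; apply: (hx t).
by rewrite (int0 t)// (curl0 t).
Qed.

(** The local double sum extends to all degrees of freedom, since by [phi_eq0] the added fields and
    their curls vanish almost everywhere on the subdomain. *)
Lemma neumann_form i (u : 'cV[R]_n) :
  dotc (neumann mu eps gamma phi (Omi i) (dofs phi (Omi i))
        *m (restr R (dofs phi (Omi i)) *m u)) (restr R (dofs phi (Omi i)) *m u)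
  = Rintegral (leb3 R) (Omi i) (quad u).
Proof.
rewrite quad_Rintegral//; last by move=> x [].
set J := dofs _ _.
have Ru a : (restr R J *m u) a 0 = u (enum_val a) 0.
  rewrite mxE (bigD1 (enum_val a))//= !mxE eqxx mul1r big1 ?addr0// => k ka.
  by rewrite !mxE eq_sym (negPf ka) mul0r.
have form0 k l : (k \notin J) || (l \notin J) ->
    Defs.form mu eps gamma (Omi i) (phi l) (phi k) = 0.
  move=> klJ; rewrite /Defs.form /Rintegral.
  rewrite (@ae_eq_integral _ _ _ _ _ (cst 0%E))//.
  - by rewrite integral0.
  - by apply: measurable_int (integrableS mOm _ _ (f_int k l)) => // x [].
  - case/orP: klJ => /phi_eq0;
    apply: (@filterS _ _ (ae_filter_ringOfSetsType (leb3 R))) => x h Omix /=;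
    by have [-> ->] := h Omix; rewrite !(dotr0l, dotr0r) !mulr0 addr0.
transitivity (\sum_(k in J) \sum_(l in J)
    u k 0 * u l 0 * Defs.form mu eps gamma (Omi i) (phi l) (phi k)).
  rewrite dotcE [RHS]big_enum_val; apply: eq_bigr => a _.
  rewrite mxE Ru mulr_suml [RHS]big_enum_val; apply: eq_bigr => b _.
  by rewrite Ru mxE; ring.
rewrite big_mkcond; apply: eq_bigr => k _.
case: ifPn => kJ; last first.
  by rewrite big1// => l _; rewrite form0 ?kJ// mulr0.
rewrite big_mkcond; apply: eq_bigr => l _.
by case: ifPn => lJ//; rewrite form0 ?lJ ?orbT// mulr0.
Qed.

Lemma stiffness_form (u : 'cV[R]_n) :
  dotc (stiffness mu eps gamma Om phi *m u) u = Rintegral (leb3 R) Om (quad u).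
Proof.
rewrite quad_Rintegral// dotcE; apply: eq_bigr => k _.
by rewrite mxE mulr_suml; apply: eq_bigr => l _; rewrite mxE; ring.
Qed.

(** Both sides integrate the same nonnegative density, and the maximum in [k1] ranges over exactly
    the non-null intersections. *)
Lemma neumann_sum_le (u : 'cV[R]_n) :
  \sum_i dotc (neumann mu eps gamma phi (Omi i) (dofs phi (Omi i))
        *m (restr R (dofs phi (Omi i)) *m u)) (restr R (dofs phi (Omi i)) *m u)
  <= (k1 Omi)%:R * dotc (stiffness mu eps gamma Om phi *m u) u.
Proof.
under eq_bigr do rewrite neumann_form.
rewrite stiffness_form; apply: overlap_Rintegral => //; last exact: quad_ge0.
  by move=> i x [].
move=> J hJ; rewrite /k1.
exact: leq_bigmax_cond.
Qed.

End neumann_sum.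

(** * The stable decomposition *)

Section geneo_decomposition.
Context {R : realType} {n N : nat}.
Variables (A : 'M[R]_n) (I : 'I_N -> {set 'I_n}).
Variables (ANeu D xi : forall i, 'M[R]_#|I i|) (G : {vspace 'cV[R]_n}).
Variables (tau kappa : R).
Hypotheses (A_spd : spd A) (ANeu_spd : forall i, spd (ANeu i)).
Hypothesis D_diag : forall i, is_diag_mx (D i).
Hypothesis D_unity :
  \sum_i (restr R (I i))^T *m D i *m restr R (I i) = 1%:M.
Hypothesis xi_proj :
  forall i, orth_proj (local_mx A (I i)) (mximage (restr R (I i)) G) (xi i).
Hypothesis tau_gt0 : 0 < tau.
Hypothesis neumann_le : forall u,
  \sum_i dotc (ANeu i *m (restr R (I i) *m u)) (restr R (I i) *m u)
  <= kappa * dotc (A *m u) u.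

(** The partition of unity reduces [u] to the local vectors [U i]. Each splits three ways:
    [xi i *m U i] feeds [g] in [V_G], while [1 - xi i] applied to [U i - F i *m U i] and to
    [F i *m U i] feeds [e] in [V_GenEO] and the stable [w i]. *)
Lemma geneo_decomposition m (Z : 'M[R]_(n, m)) u :
  basis_mx Z (V_0 A ANeu D xi G tau) ->
  exists z (w : forall i, 'cV[R]_#|I i|),
    u = Z *m z + \sum_i (restr R (I i))^T *m w i /\
    \sum_i dotc (local_mx A (I i) *m w i) (w i)
      <= kappa * tau * dotc (A *m u) u.
Proof.
move=> [_ V0E]; pose Q i := restr R (I i); pose U i := Q i *m u.
pose S i := D i *m (1%:M - xi i).
have trD i : (D i)^T = D i.
  have /is_diag_mxP D0 := D_diag i.
  apply/matrixP => a b; rewrite mxE; have [->//|ab] := eqVneq a b.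
  by rewrite !D0// eq_sym.
(* Since [D i] is symmetric, the GenEO matrix is a congruence of [local_mx]: it is symmetric, and
   its quadratic form is the local energy of [S i *m v]. *)
have SE i : (1%:M - (xi i)^T) *m D i *m local_mx A (I i) *m D i *m (1%:M - xi i)
    = (S i)^T *m local_mx A (I i) *m S i.
  by rewrite /S trmx_mul trD [(_ - _)^T]linearB/= trmx1 !mulmxA.
have symS i : ((S i)^T *m local_mx A (I i) *m S i)^T
    = (S i)^T *m local_mx A (I i) *m S i.
  exact: congruence_sym (local_mx_spd A_spd (I i)).1.
pose split i := cid (gen_eigen_split (symS i) (ANeu_spd i) (ltW tau_gt0)).
pose F i := projT1 (split i).
have F_low i v : dotc (local_mx A (I i) *m (S i *m (F i *m v)))
    (S i *m (F i *m v)) <= tau * dotc (ANeu i *m v) v.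
  by rewrite -quad_congruence; exact: (projT2 (split i)).2.
have F_high i v : V_GenEO_loc A (ANeu i) (D i) (xi i) tau
    ((Q i)^T *m S i *m (v - F i *m v)).
  have [k [w [w_eig [c ->]]]] := (projT2 (split i)).1 v.
  exists [seq (Q i)^T *m S i *m w j | j <- enum 'I_k] => [y|].
    move=> /mapP[j _ ->]; have [lam wj tlam] := w_eig j.
    by exists (w j), lam; rewrite SE; split=> //; rewrite /S !mulmxA.
  rewrite mulmx_sumr rpred_sum// => j _; rewrite -scalemxAr rpredZ//.
  by apply: memv_span; apply: map_f; rewrite mem_enum.
pose w i := S i *m (F i *m U i).
pose g := \sum_i (Q i)^T *m D i *m (xi i *m U i).
pose e := \sum_i (Q i)^T *m S i *m (U i - F i *m U i).
have uE : u = g + e + \sum_i (Q i)^T *m w i.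
  rewrite -!big_split -[LHS]mul1mx -D_unity mulmx_suml.
  apply: eq_bigr => i _ /=.
  rewrite -[LHS]mulmxA -/(U i) /w; move: (U i) (F i) => v P.
  rewrite /S -addrA -!mulmxA -!mulmxDr subrK.
  by rewrite mulmxBl mul1mx addrC subrK.
have gG : g \in V_G D G.
  apply: memv_sumr => i _.
  set B := (Q i)^T *m D i.
  have -> : B *m (xi i *m U i)
      = linfun (mulmx B : 'cV[R]_#|I i| -> 'cV[R]_n) (xi i *m U i).
    by rewrite lfunE.
  by apply: memv_img; have [] := @xi_proj i (U i).
have eE : V_GenEO A ANeu D xi tau e.
  exists [seq (Q i)^T *m S i *m (U i - F i *m U i) | i <- enum 'I_N] => [y|].
    by move=> /mapP[i _ ->]; exists i.
  rewrite rpred_sum// => i _.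
  by apply: memv_span; apply: (map_f (fun i => _)); rewrite mem_enum.
have : V_0 A ANeu D xi G tau (g + e) by exists g => //; exists e.
rewrite V0E => -[z _ zE]; exists z, w; split; first by rewrite zE.
rewrite [kappa * tau]mulrC -mulrA.
apply: (@le_trans _ _ (tau * \sum_i dotc (ANeu i *m U i) (U i))).
  by rewrite mulr_sumr; apply: ler_sum => i _; exact: F_low.
by rewrite ler_pM2l//; exact: neumann_le.
Qed.

End geneo_decomposition.

Theorem theorem3p9 (R : realType) (M N n : nat)
    (Om : set (R3 R)) (mu eps : R3 R -> R) (gamma : R)
    (K : 'I_M -> set (R3 R)) (phi : 'I_n -> R3 R -> 'rV[R]_3)
    (T : 'I_N -> {set 'I_M}) (G : {vspace 'cV[R]_n}) (tau : R) :
  bounded_domain Om -> coefficient Om mu -> coefficient Om eps -> 0 < gamma ->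
  is_mesh Om K -> fe_basis Om K phi ->
  let A := stiffness mu eps gamma Om phi in
  let Omi := fun i : 'I_N => subdomain Om K (T i) in
  Om = \bigcup_i Omi i ->
  let I := fun i : 'I_N => dofs phi (Omi i) in
  let Rst := fun i : 'I_N => restr R (I i) in
  let ANeu := fun i : 'I_N => neumann mu eps gamma phi (Omi i) (I i) in
  (forall i, spd (ANeu i)) ->
  forall D : (forall i, 'M[R]_#|I i|),
  (forall i, is_diag_mx (D i)) ->
  (forall i a, 0 <= D i a a) ->
  \sum_(i < N) (Rst i)^T *m D i *m Rst i = 1%:M ->
  forall xi : (forall i, 'M[R]_#|I i|),
  (forall i, orth_proj (local_mx A (I i)) (mximage (Rst i) G) (xi i)) ->
  0 < tau ->
  forall (m : nat) (Z : 'M[R]_(n, m)),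
  basis_mx Z (V_0 A ANeu D xi G tau) ->
  cond (M_AS2_inv A I Z *m A) <= (1 + (k1 Omi)%:R * tau) * (k0 A I)%:R.
Proof.
move=> Om_dom mu_coef eps_coef gamma0 K_mesh phi_basis A Omi _ I Rst ANeu.
move=> ANeu_spd D D_diag _ D_unity xi xi_proj tau0 m Z Z_basis.
have neumann_le u : \sum_i dotc (ANeu i *m (Rst i *m u)) (Rst i *m u)
    <= (k1 Omi)%:R * dotc (A *m u) u.
  exact: neumann_sum_le.
have restr_neq0 (u : 'cV[R]_n) : u != 0 -> exists i, Rst i *m u != 0.
  move=> u0; apply/existsP; apply: contraNT u0 => /existsPn Ru0.
  rewrite -[u]mul1mx -D_unity mulmx_suml big1// => i _.
  by have /negPn/eqP h := Ru0 i; rewrite -mulmxA h mulmx0.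
(* Definiteness is inherited from the Neumann matrices: some restriction of [u] is nonzero, so the
   left side of [neumann_le] is positive. *)
have A_spd : spd A.
  split; first exact: stiffness_sym.
  move=> u u0; have [i Riu] := restr_neq0 u u0.
  have : 0 < (k1 Omi)%:R * dotc (A *m u) u.
    apply: lt_le_trans (neumann_le u); rewrite (bigD1 i)//=.
    apply: ltr_wpDr; last exact: (ANeu_spd i).2.
    by apply: sumr_ge0 => j _; exact: (spd_psd (ANeu_spd j)).2.
  by apply: contraTT; rewrite -!leNgt; exact: mulr_ge0_le0.
(* This constant dominates both 1, for the coarse component, and [k1 tau], for the stable
   decomposition. *)
have c1 : 1 <= 1 + (k1 Omi)%:R * tau by rewrite lerDl mulr_ge0// ltW.
apply: cond_le => // [|lam]; first exact: lt_le_trans c1.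
(* The eigenvector has a nonzero restriction to some subdomain; the local matrix there is nonzero,
   so this subdomain counts itself in [k0]. *)
move=> lam_eig; move: (lam_eig) => /eigenvalueP[v _ v0].
have k0_gt0 : (0 < k0 A I)%N.
  have vT0 : v^T != 0 by rewrite trmx_eq0.
  have [i Riv] := restr_neq0 _ vT0.
  apply: leq_trans (leq_bigmax i); rewrite card_gt0.
  apply/set0Pn; exists i; rewrite inE.
  apply/eqP => A0; have := (local_mx_spd A_spd (I i)).2 _ Riv.
  by rewrite /local_mx A0 mul0mx dotc0l ltxx.
refine (two_level_eigenvalue A_spd _ k0_gt0 c1 _ _ lam_eig).
- by case: Z_basis.
- by move=> i; exact: leq_bigmax.
move=> u.
have [z [w [uE w_le]]] :=
  geneo_decomposition A_spd ANeu_spd D_diag D_unity xi_proj tau0 neumann_le u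
    Z_basis.
exists z, w; split=> //; apply: (le_trans w_le).
by rewrite ler_wpM2r// ?lerDr// (spd_psd A_spd).2.
Qed.
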